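(* Let $\mathcal{U}$ be a $\mathbb{Z}$-Ramsey ultrafilter on $\mathbb{Z}$ such that $\mathbb{Z}^+=\{z\in\mathbb{Z}: z>0\}\in\mathcal{U}$. If there exists a $1$-thin subset $A$ of $\mathbb{Z}$ such that $A\in\mathcal{U}$, then $\mathcal{U}$ is selective.
   Context: An ultrafilter is free if it is non-principal. $[\mathbb{Z}]^2$ denotes the set of $2$-element subsets of $\mathbb{Z}$. A free ultrafilter $\mathcal{U}$ on $\mathbb{Z}$ is $\mathbb{Z}$-Ramsey if, for every coloring $\chi:[\mathbb{Z}]^2\to\{0,1\}$ satisfying $\chi(\{g+x,g+y\})=\chi(\{x,y\})$ for all $\{x,y\}\in[\mathbb{Z}]^2$ and $g\in\mathbb{Z}$, there exists $U\in\mathcal{U}$ such that $\chi$ is constant on $[U]^2$. A subset $A$ of $\mathbb{Z}$ is $1$-thin if $|(g+A)\cap A|\leqslant 1$ for each $g\in\mathbb{Z}\setminus\{0\}$. A free ultrafilter $\mathcal{U}$ on an infinite set $X$ is selective if, for any partition $\mathcal{P}$ of $X$, either one cell of $\mathcal{P}$ is a member of $\mathcal{U}$, or some member of $\mathcal{U}$ meets each cell of $\mathcal{P}$ in at most one point. *)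

(* Defs.v *)
From mathcomp Require Export all_boot all_order all_algebra.
From mathcomp Require Export boolp classical_sets functions cardinality filter.

Set Implicit Arguments.
Unset Strict Implicit.
Unset Printing Implicit Defensive.

Import Order.TTheory GRing.Theory Num.Theory.
Local Open Scope classical_set_scope.
Local Open Scope card_scope.
Local Open Scope ring_scope.

Definition free_ultrafilter (T : Type) (U : set_system T) : Prop :=
  UltraFilter U /\ forall x : T, U <> principal_filter x.

(* [A]^2 *)
Definition pairs (T : Type) (A : set T) : set (set T) :=
  [set e | e `<=` A /\ e #= `I_2].

(* A coloring of [int]^2 is represented by a function on all sets of integers;
   only its values on the members of [pairs setT] are ever constrained or
   used. *)
Definition invariant_coloring (chi : set int -> bool) : Prop :=
  forall (g x y : int), pairs setT [set x; y] ->
    chi [set g + x; g + y] = chi [set x; y].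

Definition Z_Ramsey (U : set_system int) : Prop :=
  free_ultrafilter U /\
  forall chi : set int -> bool, invariant_coloring chi ->
    exists2 A, U A & exists c : bool, forall e, pairs A e -> chi e = c.

Definition one_thin (A : set int) : Prop :=
  forall g : int, g <> 0 -> ([set g + a | a in A] `&` A) #<= `I_1.

(* A free ultrafilter exists only on an infinite carrier, so the infinitude of
   [T] need not be assumed separately. *)
Definition selective (T : Type) (U : set_system T) : Prop :=
  free_ultrafilter U /\
  forall P : set (set T), partition P id [set: T] ->
    (exists2 C, P C & U C) \/
    (exists2 B, U B & forall C, P C -> (B `&` C) #<= `I_1).

(* Main.v *)
Require Import Defs.
Import Order.TTheory GRing.Theory Num.Theory.
Local Open Scope classical_set_scope.
Local Open Scope ring_scope.
Local Open Scope card_scope.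

(** In a 1-thin set [A] two distinct pairs are never translates of one another,
    so every coloring of [[A]^2] is the restriction of a translation-invariant
    one.  Hence a Z-Ramsey ultrafilter containing [A] is Ramsey for all
    colorings, in particular for the one telling whether two points lie in the
    same cell of a given partition. *)

Lemma card_le_I1 (T : Type) (A : set T) : (A #<= `I_1) <-> is_subset1 A.
Proof.
split=> [/pcard_leP/injfunPex[f fI finj] x y Ax Ay|A1].
  have f0 z : A z -> f z = 0%N by move=> /fI; rewrite /= ltnS leqn0 => /eqP.
  by apply: finj; rewrite ?inE// !f0.
have [->|/set0P[x Ax]] := eqVneq A set0; first exact: card_ge0.
suff -> : A = [set x] by rewrite (card_le_eql card_set1).
by apply/seteqP; split=> [y Ay|_ ->//]; exact: A1.
Qed.

Lemma card_set2 (T : Type) (x y : T) : x <> y -> [set x; y] #= `I_2.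
Proof.
move=> xy; pose f n := if n is 0%N then x else y.
have -> : [set x; y] = f @` `I_2.
  apply/seteqP; split=> [_ [->|->]|_ [[|n] _ <-]].
  - by exists 0%N.
  - by exists 1%N.
  - by left.
  - by right.
apply: inj_card_eq => -[|[|m]] [|[|n]]; rewrite ?inE//= => _ _ ?; exfalso;
  exact: xy.
Qed.

Lemma one_thin_extension (A : set int) (phi : set int -> bool) : one_thin A ->
  exists2 chi, invariant_coloring chi & forall e, pairs A e -> chi e = phi e.
Proof.
move=> thinA.
(* The color true spreads from the [phi]-true pairs of [A] to all their translates, and every other
   set is colored false. *)
pose chi e := `[< exists h f, [/\ pairs A f, phi f & e = +%R h @` f] >].
have tr0 (e : set int) : +%R 0 @` e = e.
  by apply: eq_image_id => z _ /=; rewrite add0r.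
exists chi => [g x y _|e Ae].
  have tr h (e : set int) : chi e -> chi (+%R h @` e).
    move=> /asboolP[k [f [Af phif ->]]]; apply/asboolP; exists (h + k), f.
    by split=> //; rewrite image_comp; apply: eq_imagel => z _ /=; rewrite addrA.
  have -> : [set g + x; g + y] = +%R g @` [set x; y].
    by rewrite image_setU !image_set1.
  (* Translations are invertible, so the other implication is [tr] applied to [- g]. *)
  apply/idP/idP; last exact: tr.
  move=> /(tr (- g)); rewrite image_comp.
  congr (is_true (chi _)).
  by apply: eq_image_id => z _ /=; rewrite addKr.
apply/asboolP/idP => [[h [f [Af phif ehf]]]|phie]; last first.
  by exists 0, e; split.
have [h0|/eqP h0] := eqVneq h 0.
  by rewrite ehf h0 tr0.
(* A nonzero shift is impossible: [e] has two points, while [h + A] and [A] share at most one by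
   1-thinness. *)
have : e `<=` [set h + a | a in A] `&` A.
  move=> z ez; split; last exact: Ae.1.
  by move: ez; rewrite ehf; apply: image_subset; exact: Af.1.
move=> /subset_card_le /card_le_trans /(_ (thinA _ h0)).
by rewrite (card_le_eql Ae.2) card_le_II.
Qed.

Lemma Ramsey_selective (T : Type) (U : set_system T) : free_ultrafilter U ->
  (forall phi : set T -> bool, exists2 B, U B &
     exists c : bool, forall e, pairs B e -> phi e = c) ->
  selective U.
Proof.
move=> fU ramU; split=> // P [coverP trivP _]; have ultraU := fU.1.
have [B UB [c Bc]] := ramU (fun e => `[< exists2 C, P C & e `<=` C >]).
have pairB x y : B x -> B y -> x <> y -> pairs B [set x; y].
  by move=> Bx By xy; split; [move=> z [->|->]|exact: card_set2].
(* If [c] is true, the cell of any one point of [B] contains all of [B], hence is in [U]; if [c] is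
   false, distinct points of [B] lie in different cells. *)
case: c Bc => Bc; [left|right; exists B => // C PC].
  have [x Bx] := filter_ex UB.
  have [C PC Cx] : cover P id x by rewrite coverP.
  exists C => //; apply: filterS UB => y By.
  have [<-//|xy] := pselect (x = y).
  have /asboolP[D PD De] := Bc _ (pairB _ _ Bx By xy).
  have Dx : D x by apply: De; left.
  have -> : C = D by apply: trivP => //; exists x.
  by apply: De; right.
apply/card_le_I1 => x y [Bx Cx] [By Cy]; apply: contrapT => xy.
have /asboolPn := Bc _ (pairB _ _ Bx By xy); apply.
by exists C => // z [->|->].
Qed.

Theorem theorem6 (U : set_system int) (hU : Z_Ramsey U)
    (hpos : U [set z : int | 0 < z]) :
  (exists A : set int, one_thin A /\ U A) -> selective U.
Proof.
case: hU => fU ramU [A [thinA UA]]; have ultraU := fU.1.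
apply: Ramsey_selective => // phi.
have [chi invchi chiE] := one_thin_extension A phi thinA.
have [B UB [c Bc]] := ramU _ invchi.
(* Outside [A] the colorings [chi] and [phi] may disagree, so [B] is cut down to [A]. *)
exists (A `&` B); first exact: filterI.
exists c => e [eAB e2]; rewrite -chiE; last first.
  by split=> // z /eAB[].
by apply: Bc; split=> // z /eAB[].
Qed.
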